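(* Let $r\geq 1$, $H=\mathbb{F}_2^r$, $n=|H|=2^r$, and let $C(z)=(z_{a+b})_{a,b\in H}$ be the group circulant in commuting variables $(z_x)_{x\in H}$. Let $\mathbf m=(m_x)_{x\in H}$ be a vector of nonnegative integers with $|\mathbf m|=\sum_{x\in H}m_x=n$. Then: (i) if $\sigma(\mathbf m)\neq 0$, then $[z^{\mathbf m}]\det C(z)=0$; (ii) if $\sigma(\mathbf m)=0$, then $$\nu_2\bigl([z^{\mathbf m}]\det C(z)\bigr)=\nu_2\!\left(\frac{n!}{\mathbf m!}\right),$$ and in particular $[z^{\mathbf m}]\det C(z)\neq 0$.
   Context: Rows and columns of $C(z)$ are indexed by $H$ in one common fixed order, and the determinant is taken over $\mathbb{Z}[z_x:x\in H]$. Notation: $z^{\mathbf m}=\prod_{x\in H}z_x^{m_x}$, $\mathbf m!=\prod_{x\in H}m_x!$, $\sigma(\mathbf m)=\sum_{x\in H}m_x x\in H$, and $[z^{\mathbf m}]F$ is the (integer) coefficient of $z^{\mathbf m}$ in $F$. For a nonzero integer $a$, $\nu_2(a)$ is the exponent of $2$ in $a$, and $\nu_2(0)=+\infty$. *)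

(* Defs.v *)
From mathcomp Require Import all_boot all_order all_algebra.
From mathcomp Require Import mpoly.

Set Implicit Arguments.
Unset Strict Implicit.
Unset Printing Implicit Defensive.

Import GRing.Theory.

Local Open Scope ring_scope.

Definition H (r : nat) : finZmodType := 'rV['F_2]_r.

Lemma card_H (r : nat) : #|H r| = (2 ^ r)%N.
Proof. by rewrite card_mx card_Fp // mul1n. Qed.

(* {mpoly int[#|H r|]} has its indeterminates numbered by 'I_#|H r|; the
   bijections enum_rank and enum_val translate between H r and 'I_#|H r|. *)
Definition zvar (r : nat) (x : H r) : {mpoly int[#|H r|]} := 'X_(enum_rank x).

(* The common order of rows and columns is that of enum (H r). *)
Definition circ (r : nat) : 'M[{mpoly int[#|H r|]}]_#|H r| :=
  \matrix_(i, j) zvar (enum_val i + enum_val j).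

Definition zmon (r : nat) (m : H r -> nat) : 'X_{1..#|H r|} :=
  [multinom m (enum_val i) | i < #|H r|].

Definition sigma (r : nat) (m : H r -> nat) : H r := \sum_x x *+ m x.

(* None stands for +oo; logn 2 0 would be 0. *)
Definition nu2 (a : int) : option nat :=
  if a == 0 then None else Some (logn 2 `|a|%N).

(* n! / m! for |m| = n, in which case the division in nat is exact. *)
Definition multinomial (r : nat) (n : nat) (m : H r -> nat) : nat :=
  (n`! %/ \prod_x (m x)`!)%N.

(* Main.v *)
(* The characters of H diagonalise C(z), so det C(z) is the product of the n
   linear forms l_a = \sum_x chi_a(x) z_x. Let s list the variables with
   multiplicities m, so that the iterated derivative d_s F at 0 equals
   m! [z^m] F. Translating the characters by b multiplies d_s (\prod_a l_a) by
   chi_b (sigma m) without changing the product, which gives (i). If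
   sigma m = 0 and s = x :: s', all n terms of the Leibniz expansion along x
   are equal, so d_s (\prod_a l_a) = n * d_s' (\prod_(a != 0) l_a).
   Finally write l_a = L - 2 b_a with L = \sum_x z_x and put N = n - 1. Since
   p! divides d_s' (L^p Q) for all Q, choosing -2 b_a in j > 0 of the N factors
   contributes a multiple of 2^j (N - j)!, which has larger 2-adic valuation
   than N! because 'C(2^r - 1, j) is odd and nu_2 (j!) < j. Hence
   d_s' (\prod_(a != 0) l_a) has the valuation of d_s' (L^N) = N!, and
   m! [z^m] det C(z) has the valuation of n!. *)
Require Import Defs.
From mathcomp Require Import all_boot all_order all_algebra.
From mathcomp Require Import mpoly.
From mathcomp Require Import ring.
From HB Require Import structures.

Set Implicit Arguments.
Unset Strict Implicit.
Unset Printing Implicit Defensive.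

Import GRing.Theory Num.Theory.

Local Open Scope ring_scope.

(** * 2-adic valuations of factorials *)

(** Halving both [i] and [2 ^ k] reduces to odd [i], where both valuations are 0. *)
Lemma logn_expB k i : (0 < i < 2 ^ k)%N -> logn 2 (2 ^ k - i) = logn 2 i.
Proof.
elim: k i => [|k IHk] i /andP[i_gt0 lt_i]; first by case: i i_gt0 lt_i => [|[]].
have [i_odd|i_even] := boolP (odd i).
  have o : odd (2 ^ k.+1 - i) by rewrite oddB 1?ltnW // i_odd oddX.
  by rewrite !logn_coprime ?coprime2n.
have Di : i = (2 * i./2)%N.
  by rewrite mul2n -[LHS]odd_double_half (negPf i_even).
have i2_gt0 : (0 < i./2)%N by case: (i./2) Di => // Di; rewrite Di in i_gt0.
have lt_i2 : (i./2 < 2 ^ k)%N by rewrite Di expnS ltn_pmul2l in lt_i.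
rewrite Di expnS -mulnBr !lognM ?subn_gt0 //; congr addn.
by rewrite IHk // i2_gt0.
Qed.

(** This is the oddness of ['C(2 ^ k - 1, j)]: raising j by one multiplies it by (2^k - (j+1)) /
    (j+1), of valuation 0 by [logn_expB]. *)
Lemma logn_fact_pred_exp k i j : (i + j = (2 ^ k).-1)%N ->
  logn 2 (2 ^ k).-1`! = (logn 2 i`! + logn 2 j`!)%N.
Proof.
elim: j i => [|j IHj] i Dij; first by rewrite addn0 in Dij; rewrite Dij addn0.
have lt_j : (j.+1 < 2 ^ k)%N.
  by rewrite -[ltnRHS]prednK ?expn_gt0 // -Dij ltnS leq_addl.
rewrite (IHj i.+1) ?addSnnS // !factS !lognM ?fact_gt0 //.
rewrite -(@logn_expB k j.+1) ?lt_j //.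
suff -> : (2 ^ k - j.+1)%N = i.+1 by rewrite addnCA addnA.
apply/eqP; rewrite -(eqn_add2r j.+1) subnK 1?ltnW //.
by rewrite addSn Dij prednK ?expn_gt0.
Qed.

Lemma logn2_fact_lt j : (0 < j)%N -> (logn 2 j`! < j)%N.
Proof.
move=> j_gt0; rewrite logn_fact //.
(* Legendre's sum is at most the geometric sum j - j / 2^K; multiplying by 2^K keeps the bound in
   [nat]. *)
have le_sum K : ((\sum_(1 <= i < K.+1) j %/ 2 ^ i) * 2 ^ K + j <= j * 2 ^ K)%N.
  elim: K => [|K IHK]; first by rewrite big_geq // mul0n add0n muln1.
  have expK : forall a, (a * 2 ^ K.+1 = 2 * (a * 2 ^ K))%N.
    by move=> a; rewrite expnS mulnCA.
  rewrite big_nat_recr //= mulnDl -addnA [(j * _)%N]expK expK.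
  apply: leq_trans (_ : 2 * (_ + j) <= _)%N; last first.
    by rewrite leq_mul2l; exact: IHK.
  by rewrite -expK mulnDr -expK leq_add2l mul2n -addnn leq_add2r leq_divM.
have exp_gt0 : (0 < 2 ^ j)%N by rewrite expn_gt0.
rewrite -(ltn_pmul2r exp_gt0) (leq_trans _ (le_sum j)) //.
by rewrite -[ltnLHS]addn0 ltn_add2l.
Qed.

Lemma dvdn_exp2_fact k p j : (0 < j)%N -> (p + j = (2 ^ k).-1)%N ->
  (2 ^ (logn 2 (2 ^ k).-1`!).+1 %| 2 ^ j * p`!)%N.
Proof.
move=> j_gt0 Dpj; rewrite pfactor_dvdn ?muln_gt0 ?expn_gt0 ?fact_gt0 //.
rewrite lognM ?expn_gt0 ?fact_gt0 // pfactorK // (logn_fact_pred_exp Dpj).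
by rewrite addnC ltn_add2r logn2_fact_lt.
Qed.

(** The same powers of [p] up to exponent e + 1 divide [a] and [b], and these already determine the
    valuation e. *)
Lemma logn_congr (p e : nat) (a b : int) : prime p -> a != 0 ->
  logn p `|a| = e -> (p%:R ^+ e.+1 %| b - a)%Z ->
  b != 0 /\ logn p `|b| = e.
Proof.
move=> p_pr a_neq0 Da dvd_ba.
have Dp i c : (p%:R ^+ i %| c)%Z = (p ^ i %| `|c|)%N by rewrite -natrX natz.
have dvdb i : (i <= e.+1)%N -> (p%:R ^+ i %| b)%Z = (p%:R ^+ i %| a)%Z.
  move=> le_i; rewrite -[b](subrK a) rpredDl //.
  by apply: dvdz_trans dvd_ba; rewrite -(subnK le_i) exprD dvdz_mull.
have Dva i : (p%:R ^+ i %| a)%Z = (i <= e)%N.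
  by rewrite Dp pfactor_dvdn ?absz_gt0 // Da.
have b_neq0 : b != 0.
  by apply/eqP => b0; have := dvdb e.+1 (leqnn _); rewrite b0 dvdz0 Dva ltnn.
split=> //; apply/eqP; rewrite eqn_leq -[(e <= _)%N]pfactor_dvdn ?absz_gt0 //.
rewrite leqNgt -[(e < _)%N]pfactor_dvdn ?absz_gt0 //.
move: (dvdb e (leqnSn _)) (dvdb e.+1 (leqnn _)).
by rewrite !Dva leqnn ltnn !Dp => -> ->.
Qed.

(** * Iterated derivatives at the origin *)

Section IteratedDerivative.
Variable n : nat.
Implicit Types (s : seq 'I_n) (p q : {mpoly int[n]}) (w : 'I_n -> int).

Definition dercoef s p : int := (foldl (fun q i => q^`M(i)) p s)@_0.

Lemma dercoef_is_linear s : scalar (dercoef s).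
Proof.
elim: s => [|i s IHs] c p q; rewrite /dercoef /=; first by rewrite linearP.
by rewrite linearP /= [LHS]IHs.
Qed.

HB.instance Definition _ s :=
  GRing.isLinear.Build int {mpoly int[n]} int *%R (dercoef s)
    (dercoef_is_linear s).

Lemma dercoef_cons i s p : dercoef (i :: s) p = dercoef s p^`M(i).
Proof. by []. Qed.

(** Each derivative along i shifts a coefficient down by U_(i) with the factor by which the
    factorial of the exponent of i shrinks. *)
Lemma dercoefE s p (m := (\sum_(i <- s) U_(i))%MM) :
  dercoef s p = (\prod_i (m i)`!)%:R * p@_m.
Proof.
rewrite {}/m; elim: s p => [|i s IHs] p.
  rewrite big_nil /dercoef /= big1 ?mul1r // => i _.
  by rewrite mnm0E.
rewrite dercoef_cons IHs big_cons mcoeff_deriv addmC mulrnAr.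
set m := (\sum_(j <- s) _)%MM; rewrite -mulrnAl -mulrnA; congr (_%:R * _).
rewrite (bigD1 i) //= [RHS](bigD1 i) //= mnmDE mnm1E eqxx add1n factS.
rewrite mulnAC [X in (X * _)%N = _]mulnC; congr (_ * _)%N.
by apply: eq_bigr => j /negPf ji; rewrite mnmDE mnm1E eq_sym ji add0n.
Qed.

(** The weight [fun=> 1] gives L; the values of chi_a give l_a. *)
Definition linform w : {mpoly int[n]} := \sum_i w i *: 'X_i.

Lemma mderiv_linform w i : (linform w)^`M(i) = (w i)%:MP.
Proof.
rewrite /linform linear_sum (bigD1 i) //= big1 ?addr0 => [|j /negPf ji].
  rewrite mderivZ mderivX mnm1E eqxx scale1r -mul_mpolyC.
  have -> : (U_(i) - U_(i) = 0 :> 'X_{1..n})%MM.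
    by apply/mnmP => j; rewrite mnmBE subnn mnm0E.
  by rewrite mpolyX0 mulr1.
by rewrite mderivZ mderivX mnm1E ji scale0r scaler0.
Qed.

Lemma mderiv_linformX i k :
  (linform (fun=> 1) ^+ k.+1)^`M(i) = k.+1%:R *: linform (fun=> 1) ^+ k.
Proof.
elim: k => [|k IHk]; first by rewrite expr1 mderiv_linform expr0 scale1r mpolyC1.
rewrite exprS mderivM IHk mderiv_linform mul1r -scalerAr -exprS.
by rewrite -{1}[_ ^+ k.+1]scale1r -scalerDl nat1r.
Qed.

Lemma dercoef_linformX s :
  dercoef s (linform (fun=> 1) ^+ size s) = (size s)`!%:R.
Proof.
elim: s => [|i s IHs]; first by rewrite /dercoef /= expr0 mcoeff1 eqxx.
by rewrite dercoef_cons mderiv_linformX linearZ /= IHs factS natrM.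
Qed.

(** In the product rule a derivative hitting L^k releases the factor k, and one hitting [q] leaves
    L^k intact; a power of L left at the end vanishes at 0. *)
Lemma dvdz_fact_dercoef s k q :
  (k`!%:R %| dercoef s (linform (fun=> 1) ^+ k * q))%Z.
Proof.
elim: s k q => [|i s IHs] [|k] q; rewrite ?dvd1z //.
  rewrite /dercoef /= exprS -mulrA rmorphM /= /linform raddf_sum.
  rewrite big1 ?mul0r ?dvdz0 //.
  by move=> i _ /=; rewrite mcoeffZ mcoeffX mnm1_eq0 mulr0.
rewrite dercoef_cons mderivM linearD /= rpredD ?IHs //.
by rewrite mderiv_linformX -scalerAl linearZ /= factS natrM dvdz_mul ?dvdzz ?IHs.
Qed.

(* Here q collects the j factors b already taken out of the product. *)
Lemma dercoef_prod_sub2_gt0 k s bs (p j : nat) q (e := logn 2 (2 ^ k).-1`!) :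
  (0 < j)%N -> (p + size bs + j = (2 ^ k).-1)%N ->
  (2%:R ^+ e.+1 %| 2%:R ^+ j * dercoef s (linform (fun=> 1) ^+ p *
     (q * \prod_(b <- bs) (linform (fun=> 1) - b *+ 2))))%Z.
Proof.
elim: bs p j q => [|b bs IHbs] p j q j_gt0 Dn.
  apply: dvdz_trans (_ : (2%:R ^+ j * p`!%:R)%R %| _)%Z; last first.
    by rewrite dvdz_mul ?dvdz_fact_dercoef.
  rewrite -!natrX -natrM !natz dvdzE /=.
  by apply: dvdn_exp2_fact; rewrite // -Dn addn0.
rewrite big_cons; set P := \prod_(_ <- _) _.
(* The factor L - 2b either adds an L to the power, or contributes -2b, which raises [j] and moves b
   into [q]. *)
have -> : linform (fun=> 1) ^+ p * (q * ((linform (fun=> 1) - b *+ 2) * P)) =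
   linform (fun=> 1) ^+ p.+1 * (q * P) -
   (linform (fun=> 1) ^+ p * (q * b * P)) *+ 2.
  by rewrite mulr2n exprS; move: (_ ^+ p) => Lp; ring.
rewrite linearB /= mulrBr rpredB ?IHbs //; first by rewrite -Dn addSnnS.
rewrite raddfMn /= mulrnAr -mulrnAl -mulr_natr -exprSr IHbs //.
by rewrite -Dn /= !addnS.
Qed.

(** Expanding factor by factor, the first choice of -2b falls under the previous lemma with j = 1;
    only the pure power of L remains. *)
Lemma dercoef_prod_sub2 k s bs (p : nat) (e := logn 2 (2 ^ k).-1`!) :
  (p + size bs = (2 ^ k).-1)%N -> size s = (2 ^ k).-1 ->
  (2%:R ^+ e.+1 %| dercoef s (linform (fun=> 1) ^+ p *
     \prod_(b <- bs) (linform (fun=> 1) - b *+ 2)) - (2 ^ k).-1`!%:R)%Z.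
Proof.
move=> Dn Ds; elim: bs p Dn => [|b bs IHbs] p Dn.
  have -> : p = size s by rewrite Ds -Dn addn0.
  by rewrite big_nil mulr1 dercoef_linformX Ds subrr dvdz0.
rewrite big_cons mulrBl mulrBr mulrA -exprSr linearB /= addrAC rpredB //.
  by rewrite IHbs // -Dn addSnnS.
rewrite mulrnAl mulrnAr raddfMn /= -[_ *+ 2]mulr_natl.
by apply: (@dercoef_prod_sub2_gt0 k s bs p 1); rewrite // -Dn addn1 addnS.
Qed.

Lemma mderiv_prod (T : finType) (A : {set T}) (F : T -> {mpoly int[n]}) i :
  (\prod_(a in A) F a)^`M(i) =
  \sum_(a in A) (F a)^`M(i) * \prod_(b in A :\ a) F b.
Proof.
have [k] := ubnP #|A|; elim: k A => // k IHk A lt_Ak.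
have [->|[a0 a0A]] := set_0Vmem A; first by rewrite !big_set0 mderivC.
rewrite (big_setD1 a0) //= mderivM IHk; last first.
  by rewrite (cardsD1 a0) a0A in lt_Ak.
rewrite [RHS](big_setD1 a0) //=; congr (_ + _).
rewrite mulr_sumr; apply: eq_bigr => a; rewrite !inE => /andP[aa0 aA].
rewrite mulrCA; congr (_ * _); rewrite [RHS](big_setD1 a0) /=; last first.
  by rewrite !inE eq_sym aa0.
by rewrite !setDDl setUC.
Qed.

Lemma dercoef_cons_prod (T : finType) (A : {set T}) (w : T -> 'I_n -> int) i s :
  dercoef (i :: s) (\prod_(a in A) linform (w a)) =
  \sum_(a in A) w a i * dercoef s (\prod_(b in A :\ a) linform (w b)).
Proof.
rewrite dercoef_cons mderiv_prod linear_sum; apply: eq_bigr => a _.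
by rewrite mderiv_linform mul_mpolyC linearZ.
Qed.

End IteratedDerivative.

Lemma big_enum_valT (R : Type) (idx : R) (op : Monoid.com_law idx) (T : finType)
    (F : T -> R) :
  \big[op/idx]_(i < #|T|) F (enum_val i) = \big[op/idx]_x F x.
Proof.
rewrite (reindex enum_rank) /=; last exact: onW_bij (enum_rank_bij _).
by apply: eq_bigr => x _; rewrite enum_rankK.
Qed.

(** * Characters of H and the factorisation of the determinant *)

Section Characters.
Variable r : nat.
Implicit Types (a b x y : H r) (s : seq 'I_#|H r|).

Definition sgn2 (u : 'F_2) : int := (-1) ^+ (u != 0).

Lemma sgn2D : {morph sgn2 : u v / u + v >-> u * v}.
Proof. by case=> [[|[]] //] ? [[|[]] //] ?. Qed.

(** The standard bilinear form identifies H with its character group, so characters are indexed by H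
    and [chi] is symmetric. *)
Definition chi a b : int := sgn2 ((a *m b^T) 0 0).

Lemma chiC a b : chi a b = chi b a.
Proof. by rewrite /chi -[in LHS](trmxK a) -trmx_mul mxE. Qed.

Lemma chiDr a : {morph chi a : x y / x + y >-> x * y}.
Proof. by move=> x y; rewrite /chi linearD mulmxDr mxE sgn2D. Qed.

Lemma chiDl x : {morph chi^~ x : a b / a + b >-> a * b}.
Proof. by move=> a b; rewrite !(chiC _ x) chiDr. Qed.

Lemma chi0 a : chi a 0 = 1.
Proof. by rewrite /chi linear0 mulmx0 mxE. Qed.

Lemma addHH x : x + x = 0.
Proof. by apply/rowP => i; rewrite !mxE -mulr2n -mulr_natr pchar_Fp_0 ?mulr0. Qed.

Lemma chi_sqr a x : chi a x * chi a x = 1.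
Proof. by rewrite -chiDr addHH chi0. Qed.

Lemma exists_chi_neq1 x : x != 0 -> exists a, chi a x = -1.
Proof.
case/rV0Pn => i xi0; exists (delta_mx 0 i).
by rewrite /chi -rowE !mxE /sgn2 xi0.
Qed.

(** Translating the index by some b with chi_b(x) = -1 negates the sum. *)
Lemma sum_chi x : x != 0 -> \sum_a chi a x = 0.
Proof.
case/exists_chi_neq1 => b chib.
suff eqN : \sum_a chi a x = - \sum_a chi a x.
  by apply/eqP; rewrite -eqNr -eqN.
rewrite [LHS](reindex_inj (addrI b)) -sumrN; apply: eq_bigr => a _ /=.
by rewrite chiDl chib mulN1r.
Qed.

Definition charform a : {mpoly int[#|H r|]} :=
  linform (fun i => chi a (enum_val i)).

Lemma charformE a : charform a = \sum_x chi a x *: zvar x.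
Proof.
rewrite -big_enum_valT.
by apply: eq_bigr => i _; rewrite /zvar enum_valK.
Qed.

(** The columns of the character table X are eigenvectors of C(z); X X = n I makes det X nonzero, so
    it can be cancelled. *)
Lemma det_circ : \det (circ r) = \prod_(a in [set: H r]) charform a.
Proof.
pose X : 'M[{mpoly int[#|H r|]}]_#|H r| :=
  \matrix_(i, j) (chi (enum_val i) (enum_val j))%:MP.
pose D := diag_mx (\row_(i < #|H r|) charform (enum_val i)).
have circX : circ r *m X = X *m D.
  apply/matrixP => i j; rewrite mul_mx_diag !mxE charformE.
  under eq_bigr do rewrite !mxE.
  rewrite (big_enum_valT _ (fun y =>
    zvar (enum_val i + y) * (chi y (enum_val j))%:MP)).
  rewrite (reindex_inj (addrI (enum_val i))) mulr_sumr; apply: eq_bigr => y _.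
  rewrite addrA addHH add0r chiDl mpolyCM (chiC y).
  by rewrite -mul_mpolyC mulrCA [zvar _ * _]mulrC.
have XX : X *m X = (#|H r|%:R)%:M.
  apply/matrixP => i j; rewrite !mxE.
  under eq_bigr do rewrite !mxE -mpolyCM chiC -chiDr.
  rewrite (big_enum_valT _ (fun y => (chi y (enum_val i + enum_val j))%:MP)).
  rewrite -raddf_sum /=.
  have [->|ij] := eqVneq i j.
    rewrite addHH; under eq_bigr do rewrite chi0.
    by rewrite sumr_const mpolyC_nat.
  rewrite sum_chi ?mpolyC0 //; apply: contraNneq ij => eij.
  by apply/eqP/enum_val_inj/(addIr (enum_val j)); rewrite eij addHH.
have detX : \det X != 0.
  have /eqP := congr1 determinant XX; rewrite det_mulmx det_scalar.
  apply: contraTneq => ->; rewrite mul0r eq_sym expf_eq0 negb_and.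
  by rewrite -mpolyC_nat mpolyC_eq0 pnatr_eq0 card_H -lt0n expn_gt0 orbT.
have : \det X * \det (circ r) = \det X * \det D.
  by rewrite mulrC -!det_mulmx circX.
move/(mulfI detX) ->; rewrite det_diag.
under eq_bigr do rewrite mxE.
by rewrite big_enum_valT; apply: eq_bigl => a; rewrite inE.
Qed.

Lemma chi_sum a (I : Type) (t : seq I) (F : I -> H r) :
  chi a (\sum_(i <- t) F i) = \prod_(i <- t) chi a (F i).
Proof. by rewrite (big_morph _ (chiDr a) (chi0 a)). Qed.

(* Translating the set of characters by b amounts to rescaling every z_x
   by chi b x. *)
Lemma dercoef_prod_charform_translate s (A : {set H r}) b :
  dercoef s (\prod_(a in A) charform (b + a)) =
  chi b (\sum_(i <- s) enum_val i) * dercoef s (\prod_(a in A) charform a).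
Proof.
rewrite chi_sum; elim: s A => [|i s IHs] A.
  (* Without derivatives left only constant terms count, and every linear form has constant term
     0. *)
  rewrite big_nil mul1r /dercoef /= !rmorph_prod /=; apply: eq_bigr => a _.
  rewrite /charform /linform !raddf_sum; apply: eq_bigr => i _ /=.
  by rewrite !mcoeffZ mcoeffX mnm1_eq0 !mulr0.
rewrite !dercoef_cons_prod big_cons mulr_sumr; apply: eq_bigr => a _.
by rewrite IHs chiDl mulrACA.
Qed.

Lemma dercoef_det_circ_eq0 s :
  \sum_(i <- s) enum_val i != 0 -> dercoef s (\det (circ r)) = 0.
Proof.
case/exists_chi_neq1 => b chib; apply/eqP; rewrite -eqNr.
rewrite -mulN1r -chib det_circ -dercoef_prod_charform_translate.
apply/eqP; rewrite [in RHS](reindex_inj (addrI b)); congr dercoef.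
by apply: eq_bigl => a; rewrite !inE.
Qed.

(** The characters other than a are the a + b with b nonzero, so the Leibniz term of a carries
    chi_a(i) chi_a(sum of s); the two arguments agree in characteristic 2, and the square is 1. *)
Lemma dercoef_cons_det_circ i s :
  \sum_(j <- i :: s) enum_val j = 0 ->
  dercoef (i :: s) (\det (circ r)) =
  #|H r|%:R * dercoef s (\prod_(a in [set~ 0]) charform a).
Proof.
rewrite big_cons => /eqP; rewrite addr_eq0 => /eqP Di.
rewrite det_circ dercoef_cons_prod.
pose c := dercoef s (\prod_(a in [set~ 0]) charform a).
transitivity (\sum_(a in [set: H r]) c); last first.
  by rewrite sumr_const cardsT mulr_natl.
apply: eq_bigr => a _.
have -> : \prod_(b in setT :\ a) charform b =
    \prod_(b in [set~ 0]) charform (a + b).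
  rewrite (reindex_inj (addrI a)); apply: eq_bigl => b.
  by rewrite !inE andbT -subr_eq0 addrAC subrr add0r.
rewrite dercoef_prod_charform_translate mulrA Di.
suff -> : - (\sum_(j <- s) enum_val j) = \sum_(j <- s) enum_val j :> H r.
  by rewrite chi_sqr mul1r.
by apply/eqP; rewrite eq_sym -addr_eq0 addHH.
Qed.

(** The form b_a collects the variables at which chi_a is -1. *)
Lemma charform_sub2 a :
  charform a =
    linform (fun=> 1) - (\sum_(i | chi a (enum_val i) != 1) 'X_i) *+ 2.
Proof.
rewrite /charform /linform -sumrMnl [X in _ - X]big_mkcond -sumrB.
apply: eq_bigr => i _; rewrite scale1r; case: ifP; last first.
  by move/negbFE/eqP->; rewrite scale1r subr0.
rewrite /chi /sgn2; case: (_ != 0) => // _.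
by rewrite expr1 scaleN1r mulr2n opprD addrA subrr add0r.
Qed.

Lemma logn_dercoef_det_circ s : size s = #|H r| ->
  \sum_(i <- s) enum_val i = 0 ->
  dercoef s (\det (circ r)) != 0 /\
  logn 2 `|dercoef s (\det (circ r))| = logn 2 #|H r|`!.
Proof.
have H_gt0 : (0 < #|H r|)%N by rewrite card_H expn_gt0.
case: s => [|i s] Ds sum0; first by rewrite -Ds in H_gt0.
rewrite dercoef_cons_det_circ //.
have {}Ds : size s = (2 ^ r).-1.
  by rewrite -(congr1 predn (card_H r)) -(congr1 predn Ds).
pose neg a : {mpoly int[#|H r|]} := \sum_(i | chi a (enum_val i) != 1) 'X_i.
pose bs := [seq neg a | a <- enum [set~ (0 : H r)]].
have Dbs : (0 + size bs = (2 ^ r).-1)%N.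
  by rewrite size_map -cardE cardsC1 card_H.
have := dercoef_prod_sub2 Dbs Ds; rewrite expr0 mul1r.
have -> : \prod_(b <- bs) (linform (fun=> 1) - b *+ 2) =
    \prod_(a in [set~ 0]) charform a.
  by rewrite big_map big_enum; apply: eq_bigr => a _; rewrite charform_sub2.
case/(@logn_congr 2 _ _ _ isT); rewrite ?natz ?eqz_nat -?lt0n ?fact_gt0 //.
move=> d_neq0 Dd; rewrite mulf_neq0 ?eqz_nat -?lt0n //; split=> //.
rewrite abszM lognM ?absz_gt0 ?eqz_nat -?lt0n // Dd -card_H.
by rewrite -[in RHS](prednK H_gt0) factS lognM ?fact_gt0 ?prednK.
Qed.

End Characters.

(** * From derivatives back to coefficients *)

Lemma nu2_neq0 (a : int) (e : nat) : a != 0 -> logn 2 `|a| = e -> nu2 a = Some e.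
Proof. by rewrite /nu2 => /negPf -> ->. Qed.

(** The second clause is used both in H, for sigma m, and in [nat], for the length of s. *)
Lemma exists_mnm_seq n (m : 'X_{1..n}) :
  exists2 s, m = (\sum_(i <- s) U_(i))%MM &
    forall (V : nmodType) (F : 'I_n -> V), \sum_(i <- s) F i = \sum_i F i *+ m i.
Proof.
pose s := flatten [seq nseq (m i) i | i <- enum 'I_n].
have sumE (V : nmodType) (F : 'I_n -> V) : \sum_(i <- s) F i = \sum_i F i *+ m i.
  rewrite big_flatten big_map big_enum; apply: eq_bigr => i _.
  by rewrite big_nseq iter_addr_0.
exists s => //; apply/mnmP => j; rewrite mnm_sumE.
transitivity (\sum_i (i == j : nat) *+ m i).
  rewrite (bigD1 j) //= eqxx big1 ?addr0 => [|i /negPf ->].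
    by rewrite -[LHS]natn.
  by rewrite mul0rn.
by rewrite -sumE; apply: eq_bigr => i _; rewrite mnm1E.
Qed.

Theorem theorem6 (r : nat) (hr : (1 <= r)%N) (m : H r -> nat)
    (hm : (\sum_x m x)%N = #|H r|) :
  (sigma m <> 0 -> (\det (circ r))@_(zmon m) = 0) /\
  (sigma m = 0 ->
     nu2 (\det (circ r))@_(zmon m) = nu2 (multinomial #|H r| m)%:Z /\
     (\det (circ r))@_(zmon m) <> 0).
Proof.
have [s Dm sumE] := exists_mnm_seq (zmon m).
have sum_s : \sum_(i <- s) enum_val i = sigma m.
  by rewrite sumE /sigma -[RHS]big_enum_valT; apply: eq_bigr => i _; rewrite mnmE.
have size_s : size s = #|H r|.
  apply: etrans hm; rewrite -[RHS]big_enum_valT -sum1_size [LHS](sumE nat).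
  by apply: eq_bigr => i _; rewrite mnmE natn.
pose f := (\prod_x (m x)`!)%N.
have f_gt0 : (0 < f)%N by rewrite prodn_gt0 // => x; rewrite fact_gt0.
have dercoef_s p : dercoef s p = f%:R * p@_(zmon m).
  rewrite dercoefE -Dm /f -[in RHS]big_enum_valT; congr (_%:R * _).
  by apply: eq_bigr => i _; rewrite mnmE.
have f_neq0 : f%:R != 0 :> int by rewrite natz eqz_nat -lt0n.
split=> [/eqP sigma_neq0|sigma0].
  apply: (mulfI f_neq0); rewrite mulr0 -dercoef_s.
  by rewrite dercoef_det_circ_eq0 ?sum_s.
have /(_ size_s) := @logn_dercoef_det_circ r s.
rewrite sum_s dercoef_s mulf_eq0 negb_or => /(_ sigma0)[/andP[_ c_neq0] Dc].
(* Since m! [z^m] L^n = n!, the division in [multinomial] is exact. *)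
have f_dvd : (f %| #|H r|`!)%N.
  have := dercoef_linformX s; rewrite dercoef_s size_s => /(congr1 absz).
  by rewrite abszM !natz /= => <-; rewrite dvdn_mulr.
split; last exact/eqP.
rewrite (nu2_neq0 c_neq0 erefl); apply/esym/nu2_neq0.
  by rewrite eqz_nat -lt0n divn_gt0 // dvdn_leq ?fact_gt0.
rewrite /multinomial /= logn_div // -/f -Dc abszM natz lognM ?absz_gt0 //;
  last by rewrite -lt0n.
by rewrite addKn.
Qed.
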